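(* Let $r_1,r_2\ge 1$, let $G_1$ and $G_2$ be regular subgroups of $\mathrm{GA}(r_1,2)$ and $\mathrm{GA}(r_2,2)$ respectively, and let $T$ and $S$ be automorphisms of the groups $G_1$ and $G_2$ respectively. Let $\tau$ and $\sigma$ be the permutations (of $F^{r_1}$ and $F^{r_2}$) induced by $T$ and $S$, with distensions $l_1$ and $l_2$ and deficiencies $k_1$ and $k_2$ respectively. Then $S_{\mathcal H,\tau|\sigma}$ is a propelinear extended perfect code of length $2^{r_1+r_2+1}$ with $$\mathrm{rank}(S_{\mathcal H,\tau|\sigma})=2^{r_1+r_2+1}-r_1-r_2-2+l_1+l_2$$ and $$\dim(\mathrm{Ker}(S_{\mathcal H,\tau|\sigma}))=2^{r_1+r_2+1}-r_1-r_2-2-k_1-k_2.$$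
   Context: $F=\mathrm{GF}(2)$; $F^n$ carries the Hamming metric; a code of length $n$ is a set of vectors of $F^n$, whose elements are called codewords. $\mathrm{wt}$ is Hamming weight. ${\bf 0}$ denotes the all-zero vector; $x|y$ denotes concatenation. A code $C\subseteq F^n$ is perfect if for every $x\in F^n$ there is exactly one $y\in C$ at Hamming distance at most $1$ from $x$. An extended perfect code is obtained from a perfect code by adding an overall parity check coordinate to all codewords (its position is immaterial). The rank of a code is the dimension of its linear span over $F$. The kernel $\mathrm{Ker}(C)$ of a code $C$ of length $n$ is the set of all $x\in F^n$ with $x+C=C$ (a linear subspace). $\mathrm{Aut}(F^n)$ is the group of all transformations $(x,\pi)$, $x\in F^n$, $\pi$ a permutation of the coordinate positions, acting by $(x,\pi)(y)=x+\pi(y)$ where $\pi(y)=(y_{\pi^{-1}(1)},\ldots,y_{\pi^{-1}(n)})$. $\mathrm{Aut}(C)$ is the setwise stabilizer of $C$ in $\mathrm{Aut}(F^n)$. A group acting on a set is regular if it acts transitively and its order equals the size of the set. A code $C$ is propelinear if $\mathrm{Aut}(C)$ has a subgroup acting regularly on the codewords of $C$. For each $r\ge1$: the coordinates of $F^{2^r}$ are indexed by the vectors of $F^r$; $e_a$ is the vector whose only nonzero coordinate is the one indexed by $a$; $\mathcal H=\{c\in F^{2^r}:\sum_{a:c_a=1}a={\bf 0},\ \mathrm{wt}(c)\equiv 0 \pmod 2\}$ and $\mathcal H_a=\mathcal H+e_a+e_{\bf 0}$. For a bijection $\rho:F^r\to F^r$, $S_{\mathcal H,\rho}=\bigcup_{a\in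 F^r}\mathcal H_a\times\mathcal H_{\rho(a)}$, where $C\times D=\{x|y:x\in C,y\in D\}$. In $S_{\mathcal H,\tau|\sigma}$ one takes $r=r_1+r_2$ and $\tau|\sigma:F^{r_1+r_2}\to F^{r_1+r_2}$, $(\tau|\sigma)(x|y)=\tau(x)|\sigma(y)$ for $x\in F^{r_1}$, $y\in F^{r_2}$. For a bijection $\rho:F^r\to F^r$ with $\rho({\bf 0})={\bf 0}$: $\rho$ acts on $x\in F^{2^r}$ by permuting coordinates, $\rho(x)_b=x_{\rho^{-1}(b)}$, and the distension of $\rho$ is $2^r-r-1-\dim(\mathcal H\cap\rho(\mathcal H))$. For nonzero $a\in F^r$, $\mathrm{Star}(a)=\{\{a,b,a+b\}:b\in F^r\setminus\{{\bf 0},a\}\}$ and $\rho(\mathrm{Star}(a))=\{\{\rho(a),\rho(b),\rho(a+b)\}:b\in F^r\setminus\{{\bf 0},a\}\}$; the number of nonzero $a$ with $\rho(\mathrm{Star}(a))=\mathrm{Star}(\rho(a))$ is always a power of two minus one, and the deficiency of $\rho$ is $r-\log_2\left(|\{a\in F^r\setminus\{{\bf 0}\}:\rho(\mathrm{Star}(a))=\mathrm{Star}(\rho(a))\}|+1\right)$. $\mathrm{GA}(r,2)=\{(a,M):a\in F^r,\ M\in\mathrm{GL}(r,2)\}$ is the general affine group, acting on $F^r$ by $(a,M)(b)=a+Mb$, with composition as group operation. A subgroup $G$ of $\mathrm{GA}(r,2)$ is regular if it acts regularly on the vectors of $F^r$. For such $G$ and $a\in F^r$, $g_a$ denotes the unique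 element of $G$ mapping ${\bf 0}$ to $a$. The permutation $\tau$ of $F^r$ induced by an automorphism $T$ of the group $G$ is defined by $T(g_a)=g_{\tau(a)}$ for all $a\in F^r$ (in particular $\tau({\bf 0})={\bf 0}$). *)

(* Defs.v *)
From HB Require Import structures.
From mathcomp Require Import all_boot all_order all_algebra all_fingroup.

Set Implicit Arguments.
Unset Strict Implicit.
Unset Printing Implicit Defensive.

Import GRing.Theory.
Local Open Scope ring_scope.

(* Coordinates are indexed by an arbitrary finite type I; the length is #|I|.
   The regular module ('F_2)^o makes {ffun I -> _} an 'F_2-vector space. *)
Notation word I := {ffun I%type -> ('F_2)^o}.

Section Codes.
Variable I : finType.
Implicit Types (x y : word I) (C : {set word I}).

Definition wt x : nat := #|[set i | x i != 0]|.

Definition hdist x y : nat := #|[set i | x i != y i]|.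

Definition code_length C : nat := #|I|.

Definition perfect C : Prop :=
  forall x, exists! y, y \in C /\ (hdist x y <= 1)%N.

(* For a linear C, such as Ker C or the intersection in distension below, this
   is the dimension of C itself. *)
Definition span_dim C : nat := \dim <<enum C>>%VS.

Definition rank C : nat := span_dim C.

Definition Ker C : {set word I} := [set x : word I | [set x + y | y in C] == C].

Definition permute (p : {perm I}) x : word I := [ffun i => x (p^-1%g i)].

(* (x, p) |-> (y |-> x + p(y)) is injective, so the group of pairs is identified
   with the corresponding group of permutations of the set of words. *)
Definition AutF : {set {perm word I}} :=
  [set f : {perm word I} | [exists x : word I, exists p : {perm I},
              [forall y, f y == x + permute p y]]].

Definition AutC C : {set {perm word I}} := [set f in AutF | f @: C == C].

End Codes.

Definition acts_regularly (T : finType) (G : {group {perm T}}) (A : {set T}) :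
    Prop :=
  [transitive G, on A | 'P] /\ #|G| = #|A|.

Definition propelinear (I : finType) (C : {set word I}) : Prop :=
  exists2 G : {group {perm word I}}, G \subset AutC C & acts_regularly G C.

(* The parity check is put at coordinate None. *)
Definition parity_extend (J : finType) (x : word J) : word (option J) :=
  [ffun o => if o is Some j then x j else \sum_j x j].

Definition extended_perfect (I : finType) (C : {set word I}) : Prop :=
  exists (n : nat) (D : {set word 'I_n}) (h : I -> option 'I_n),
    [/\ bijective h, perfect D &
        C = [set ([ffun i => parity_extend x (h i)] : word I) | x in D]].

Definition concat (I J : finType) (x : word I) (y : word J) : word (I + J)%type :=
  [ffun k => match k with inl i => x i | inr j => y j end].

Notation vec r := 'cV['F_2]_r.

Section Hamming.
Variable r : nat.
Implicit Types (a b : vec r) (rho : {perm vec r}).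

Definition unit_word a : word (vec r) := [ffun b => (b == a)%:R].

Definition H : {set word (vec r)} :=
  [set c : word (vec r) | (\sum_(a | c a == 1) a == 0) && ~~ odd (wt c)].

Definition Hcoset a : {set word (vec r)} :=
  [set (c : word (vec r)) + unit_word a + unit_word 0 | c in H].

Definition SH rho : {set word (vec r + vec r)%type} :=
  \bigcup_a [set concat x y | x in Hcoset a, y in Hcoset (rho a)].

Definition distension rho : int :=
  (2 ^ r)%N%:Z - r%:Z - 1 - (span_dim (H :&: (permute rho @: H)))%:Z.

Definition Star a : {set {set vec r}} :=
  [set [set a; b; a + b] | b in ~: [set 0; a]].

Definition star_preserved rho : {set vec r} :=
  [set a | (a != 0) &&
           ([set rho @: (t : {set vec r}) | t in Star a] == Star (rho a))].

(* #|star_preserved rho| + 1 is a power of two when rho 0 = 0, so that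
   trunc_log 2 is its exact base-2 logarithm. *)
Definition deficiency rho : int :=
  r%:Z - (trunc_log 2 (#|star_preserved rho| + 1))%:Z.

(* GA r is identified with its faithful image in the permutations of F^r.
   The product of {perm _} is composition in the reverse order, which affects
   neither the subgroups nor their automorphisms. *)
Definition GA : {set {perm vec r}} :=
  [set g : {perm vec r} | [exists a : vec r, exists M : 'M['F_2]_r,
              (M \in unitmx) && [forall b : vec r, g b == a + M *m b]]].

Definition regular_GA (G : {group {perm vec r}}) : Prop :=
  G \subset GA /\ acts_regularly G [set: vec r].

(* The default value is never used when G is regular. *)
Definition elt_to (G : {group {perm vec r}}) a : {perm vec r} :=
  odflt 1%g [pick g in G | (g : {perm vec r}) 0 == a].

Definition induced_by (G : {group {perm vec r}}) (T : {perm {perm vec r}})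
    (tau : {perm vec r}) : Prop :=
  forall a, T (elt_to G a) = elt_to G (tau a).

End Hamming.

Section PermConcat.
Variables r1 r2 : nat.

Definition vconcat_fun (tau : {perm vec r1}) (sigma : {perm vec r2})
    (v : vec (r1 + r2)) : vec (r1 + r2) :=
  col_mx (tau (usubmx v)) (sigma (dsubmx v)).

Lemma vconcat_fun_inj tau sigma : injective (vconcat_fun tau sigma).
Proof.
move=> u v /eq_col_mx [/perm_inj eq1 /perm_inj eq2].
by rewrite -[u]vsubmxK -[v]vsubmxK eq1 eq2.
Qed.

Definition vconcat tau sigma : {perm vec (r1 + r2)} :=
  perm (@vconcat_fun_inj tau sigma).

End PermConcat.

(* Main.v *)
(* Writing s(x) for the sum of the coordinates a with x_a = 1, one has
     S_{H,rho} = {x|y : wt x, wt y even, s(y) = rho(s(x))}.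
   In a word of odd total weight exactly one flip restores these equations, so
   the code is extended perfect.  An affine map g permutes the coordinates so
   that s(g(x)) + g(0) = g(s(x)) on even words; hence, for c = u|v in the code
   and a = s(u), the maps x|y |-> u + g_a(x) | v + g_{rho(a)}(y) preserve the
   code and form a regular group as soon as rho(g_a(b)) = g_{rho(a)}(rho(b)),
   which says that rho is induced by an automorphism of G.

   Even pairs x|y map onto F^r x F^r by (s(x), s(y)), and the code is the
   preimage of the graph of rho, the kernel that of the graph of rho restricted
   to K = {k : rho(a + k) = rho(a) + rho(k) for all a}.  So the rank is
   2(2^r - r - 1) + D, with D the dimension of the span of the graph, and the
   kernel has dimension 2(2^r - r - 1) + dim K.  The same graph computes the
   distension, which is D - r, and a star is preserved exactly at the nonzero
   elements of K, so the deficiency is r - dim K.  Finally D and dim K are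
   additive under tau|sigma. *)
Require Import Defs.
From HB Require Import structures.
From mathcomp Require Import all_boot all_order all_algebra all_fingroup.
From mathcomp Require Import finfield ring.

Set Implicit Arguments.
Unset Strict Implicit.
Unset Printing Implicit Defensive.

Import GRing.Theory.
Local Open Scope ring_scope.

(** * Linear algebra over F_2 *)

Section SpanDimension.
Variable F : fieldType.

(** Rank-nullity for [f1] on [<<X>>]: the image is [<<Y1>>], and the kernel is the injective image
    of [<<Y2>>] under [j]. *)
Lemma dim_span_pair (A B1 B2 : vectType F) (f1 : 'Hom(A, B1)) (f2 : 'Hom(A, B2))
    (j : 'Hom(B2, A)) (X : seq A) (Y1 : seq B1) (Y2 : seq B2) :
  (forall w, f1 w = 0 -> j (f2 w) = w) ->
  (forall y, f1 (j y) = 0) -> (forall y, f2 (j y) = y) ->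
  map f1 X =i Y1 -> {subset map f2 X <= Y2} ->
  (forall y, y \in Y2 -> j y \in <<X>>%VS) ->
  \dim <<X>> = (\dim <<Y1>> + \dim <<Y2>>)%N.
Proof.
move=> jf f1j f2j e1 e2 sj.
rewrite -(limg_ker_dim f1 <<X>>) addnC limg_span (eq_span e1); congr (_ + _)%N.
have kj : lker j == 0%VS.
  apply/lker0P => y z e; by rewrite -[y]f2j e f2j.
rewrite -(@limg_dim_eq _ _ _ j <<Y2>>); last by rewrite (eqP kj) capv0.
congr (\dim _); apply/eqP; rewrite eqEsubv; apply/andP; split; apply/subvP => w.
  rewrite memv_cap memv_ker => /andP [wX /eqP w0]; rewrite -(jf _ w0) memv_img //.
  by move: (memv_img f2 wX); rewrite limg_span; apply/subvP/sub_span.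
case/memv_imgP => y yY ->; rewrite memv_cap memv_ker f1j eqxx andbT.
have : (j @: <<Y2>> <= <<X>>)%VS.
  rewrite limg_span; apply/span_subvP => z /mapP [y' y'Y ->]; exact: sj.
by move/subvP; apply; exact: memv_img.
Qed.

(** Here [X] is the preimage of 0 x [Y] under a jointly surjective pair of maps. Its span contains
    the whole common kernel, of dimension [dim A - dim B1 - dim B2], and [f2] maps it onto [<<Y>>].
    The additive form avoids truncated subtraction. *)
Lemma dim_span_preimage (A B1 B2 : vectType F) (f1 : 'Hom(A, B1))
    (f2 : 'Hom(A, B2)) (X : seq A) (Y : seq B2) :
  (forall b1 b2, exists2 w, f1 w = b1 & f2 w = b2) ->
  (forall w, (w \in X) = (f1 w == 0) && (f2 w \in Y)) -> 0 \in Y ->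
  (\dim <<X>> + (dim B1 + dim B2) = dim A + \dim <<Y>>)%N.
Proof.
move=> surj memX Y0.
have e2 : (f2 @: <<X>> = <<Y>>)%VS.
  rewrite limg_span; apply: eq_span => y; apply/mapP/idP => [[w] | yY].
    by rewrite memX => /andP [_ wY] ->.
  by have [w w1 w2] := surj 0 y; exists w; rewrite ?memX ?w1 ?w2 ?eqxx.
have sX : (<<X>> <= lker f1)%VS.
  by apply/span_subvP => w; rewrite memX memv_ker => /andP [].
(* As 0 lies in [Y], a vector killed by both maps is already an element of [X]. *)
have ek : (<<X>> :&: lker f2 = lker f1 :&: lker f2)%VS.
  apply/eqP; rewrite eqEsubv capvS //=; apply/subvP => w.
  rewrite !memv_cap => /andP [w1 w2]; rewrite w2 andbT memv_span // memX.
  by move: w1 w2; rewrite !memv_ker => -> /eqP ->.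
have l1 : limg f1 = fullv.
  apply/eqP; rewrite eqEsubv subvf; apply/subvP => b _.
  by have [w <- _] := surj b 0; rewrite memv_img ?memvf.
have l2 : (f2 @: lker f1 = fullv)%VS.
  apply/eqP; rewrite eqEsubv subvf; apply/subvP => b _.
  by have [w w1 <-] := surj 0 b; rewrite memv_img // memv_ker w1.
move: (limg_ker_dim f1 fullv); rewrite capfv l1 !dimvf.
move: (limg_ker_dim f2 (lker f1)); rewrite l2 dimvf.
move: (limg_ker_dim f2 <<X>>); rewrite e2 ek => <- <- <-.
by rewrite addnAC [(dim B1 + _)%N]addnC addnA.
Qed.

Lemma span_lker2 (A B1 B2 : vectType F) (f1 : 'Hom(A, B1))
    (f2 : 'Hom(A, B2)) (X : seq A) :
  (forall w, (w \in X) = (f1 w == 0) && (f2 w == 0)) ->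
  (<<X>> = lker f1 :&: lker f2)%VS.
Proof.
move=> memX; apply/eqP; rewrite eqEsubv; apply/andP; split.
  by apply/span_subvP => w; rewrite memX memv_cap !memv_ker.
by apply/subvP => w; rewrite memv_cap !memv_ker -memX; apply: memv_span.
Qed.

End SpanDimension.

(* Over F_2 an additive subset is a subspace. *)
Lemma size_add_closed (vT : vectType 'F_2) (X : seq vT) :
  uniq X -> 0 \in X -> (forall x y, x \in X -> y \in X -> x + y \in X) ->
  size X = (2 ^ \dim <<X>>)%N.
Proof.
move=> uX X0 XD.
have spanX : forall x, (x \in <<X>>%VS) = (x \in X).
  move=> x; apply/idP/idP => [|xX]; last exact: memv_span.
  rewrite span_def.
  suff : forall Y : seq vT, {subset Y <= X} -> forall x,
     x \in (\sum_(u <- Y) <[u]>)%VS -> x \in X by move=> hX; apply: hX.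
  elim => [|u Y IH] sY {}x; first by rewrite big_nil memv0 => /eqP ->.
  rewrite big_cons => /memv_addP [y /vlineP [k ->] [z zY ->]].
  apply: XD; last by apply: IH zY => t tY; apply: sY; rewrite inE tY orbT.
  have uX' : u \in X by apply: sY; rewrite mem_head.
  have [->|k0] := eqVneq k 0; first by rewrite scale0r.
  suff -> : k = 1 by rewrite scale1r.
  by apply/val_inj; move: k k0 => [[|[|]]].
(* The space is unpacked so that [finvect_type] can make its carrier finite and [card_vspace] can
   count the span. *)
move: X {X0 XD} uX spanX; case: vT => T cT X uX spanX.
pose fT := finvect_type (Vector.Pack cT).
rewrite -[LHS](card_uniqP (uX : @uniq fT X)).
have := @card_vspace _ fT cT <<X>>%VS; rewrite card_Fp // => <-.
by apply: eq_card => x; rewrite spanX.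
Qed.

Lemma addF2 (V : lmodType 'F_2) (x : V) : x + x = 0.
Proof.
rewrite -[x]scale1r -scalerDl; have -> : 1 + 1 = 0 :> 'F_2 by apply/val_inj.
by rewrite scale0r.
Qed.

Lemma oppF2 (V : lmodType 'F_2) (x : V) : - x = x.
Proof. by apply/eqP; rewrite eq_sym -addr_eq0 addF2. Qed.

Lemma addF2K (V : lmodType 'F_2) (x y : V) : x + y + y = x.
Proof. by rewrite -addrA addF2 addr0. Qed.

Lemma F2_neq0 (k : 'F_2) : (k != 0) = (k == 1).
Proof. by case: k => [[|[|]]]. Qed.

(** * Parity and syndrome as linear maps on words *)

Section WeightedSum.
Variables (I : finType) (U : vectType 'F_2).
Implicit Types (f : I -> U) (x y : word I).

(** The linear extension of [f] from the unit words; parity, syndrome and pairs of syndromes are all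
    of this form. *)
Definition wsum f x : U := \sum_i (x i : 'F_2) *: f i.

Lemma wsum_is_linear f : linear (wsum f).
Proof.
move=> k x y; rewrite /wsum scaler_sumr -big_split /=; apply: eq_bigr => i _.
by rewrite !ffunE scalerDl scalerA.
Qed.

HB.instance Definition _ f :=
  GRing.isLinear.Build 'F_2 (word I) U *:%R (wsum f) (wsum_is_linear f).

Definition point i : word I := [ffun j => (j == i)%:R].

Lemma wsum_point f i : wsum f (point i) = f i.
Proof.
rewrite /wsum (bigD1 i) //= big1 ?addr0 => [|j /negbTE ji].
  by rewrite ffunE eqxx scale1r.
by rewrite ffunE ji scale0r.
Qed.

Lemma wsum_permute f (p : {perm I}) x :
  wsum f (permute p x) = wsum (f \o p) x.
Proof.
rewrite /wsum (reindex_inj (@perm_inj _ p)) /=; apply: eq_bigr => i _.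
by rewrite ffunE permK.
Qed.

Lemma wsum_in_span f x : wsum f x \in <<codom f>>%VS.
Proof.
by apply: memv_suml => i _; rewrite memvZ // memv_span // codom_f.
Qed.

End WeightedSum.

Definition parity (I : finType) : word I -> ('F_2)^o :=
  wsum (fun=> 1 : ('F_2)^o).

Definition syn r : word (vec r) -> vec r := wsum (fun a : vec r => a).

Lemma parityE (I : finType) (x : word I) : parity x = \sum_i x i.
Proof. by apply: eq_bigr => i _; apply: mulr1. Qed.

(** The parity is the weight read in ['F_2], where exactly the even numbers vanish. *)
Lemma odd_wt (I : finType) (x : word I) : odd (wt x) = (parity x != 0).
Proof.
have -> : parity x = (wt x)%:R.
  rewrite parityE /wt -sum1_card natr_sum (bigID [pred i | x i != 0]) /=.
  rewrite addrC big1 ?add0r => [|i /negbNE/eqP //].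
  apply: eq_big => [i|i]; first by rewrite inE.
  by rewrite F2_neq0 => /eqP.
by rewrite -(dvdn_pcharf (pchar_Fp (isT : prime 2))) dvdn2 negbK.
Qed.

(** * The extended Hamming code and its cosets in terms of parity and syndrome *)

Section ExtendedHamming.
Variable r : nat.
Implicit Types (a b : vec r) (c : word (vec r)) (rho : {perm vec r}).

Lemma in_H c : (c \in H r) = (parity c == 0) && (syn c == 0).
Proof.
rewrite inE odd_wt negbK andbC; congr (_ && (_ == 0)).
rewrite /syn /wsum [RHS](bigID [pred a | c a == 1]) /= [X in _ + X]big1 ?addr0.
  by apply: eq_bigr => a /eqP ->; rewrite scale1r.
by move=> a; rewrite -F2_neq0 => /negbNE/eqP ->; rewrite scale0r.
Qed.

Lemma parity_point (I : finType) (i : I) : parity (point i) = 1.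
Proof. exact: wsum_point. Qed.

Lemma syn_point a : syn (point a) = a.
Proof. exact: wsum_point. Qed.

Lemma parityD (I : finType) : {morph (@parity I) : x y / x + y}.
Proof. exact: linearD. Qed.

Lemma synD : {morph (@syn r) : x y / x + y}.
Proof. exact: linearD. Qed.

(** Adding the points 0 and [a] keeps the parity and shifts the syndrome by [a]. *)
Lemma in_Hcoset a c : (c \in Hcoset a) = (parity c == 0) && (syn c == a).
Proof.
have ->: (c \in Hcoset a) = (c + point 0 + point a \in H r).
  apply/imsetP/idP => [[h hH ->]|cH].
    by rewrite -[unit_word a]/(point a) !addF2K.
  exists (c + point 0 + point a) => //.
  by rewrite -[unit_word a]/(point a) !addF2K.
rewrite in_H !parityD !synD !parity_point !syn_point addr0 addF2K.
by rewrite addr_eq0 oppF2.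
Qed.

Definition fstw (w : word (vec r + vec r)%type) : word (vec r) :=
  [ffun a => w (inl a)].
Definition sndw (w : word (vec r + vec r)%type) : word (vec r) :=
  [ffun a => w (inr a)].

Lemma fstw_concat (x y : word (vec r)) : fstw (concat x y) = x.
Proof. by apply/ffunP => a; rewrite !ffunE. Qed.

Lemma sndw_concat (x y : word (vec r)) : sndw (concat x y) = y.
Proof. by apply/ffunP => a; rewrite !ffunE. Qed.

(** The index [a] of the union is forced to be the syndrome of the left half, which eliminates
    it. *)
Lemma in_SH rho w : (w \in SH rho) =
  [&& parity (fstw w) == 0, parity (sndw w) == 0
    & syn (sndw w) == rho (syn (fstw w))].
Proof.
apply/bigcupP/and3P => [[a _ /imset2P [x y]]|[px py sxy]].
  rewrite !in_Hcoset => /andP [px /eqP <-] /andP [py sy] ->.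
  by rewrite fstw_concat sndw_concat.
exists (syn (fstw w)) => //; apply/imset2P.
exists (fstw w) (sndw w); rewrite ?in_Hcoset ?px ?py ?eqxx //.
by apply/ffunP => [[a|a]]; rewrite !ffunE.
Qed.

End ExtendedHamming.

(** * Extended perfect codes *)

(** Puncture [C] at one coordinate. The unit ball around [x] corresponds to the single flips of the
    odd word got from the extension of [x] by inverting its parity bit, so a unique flip into [C]
    means a unique codeword in the ball. The point [i0] provides a coordinate for the parity bit. *)
Lemma extended_perfect_crit (I : finType) (i0 : I) (C : {set word I}) :
  (forall w, w \in C -> parity w = 0) ->
  (forall w, parity w != 0 -> exists! i, w + point i \in C) ->
  extended_perfect C.
Proof.
move=> evenC flipC; pose n := #|I|.-1.
have cardI : #|I| = #|{: option 'I_n}|.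
  by rewrite card_option card_ord /n prednK //; apply/card_gt0P; exists i0.
(* A numbering of the coordinates in which [h' None] is the position of the parity bit. *)
pose h (i : I) : option 'I_n := enum_val (cast_ord cardI (enum_rank i)).
pose h' o : I := enum_val (cast_ord (esym cardI) (enum_rank o)).
have hK : cancel h h' by move=> i; rewrite /h /h' enum_valK cast_ordK enum_rankK.
have h'K : cancel h' h by move=> i; rewrite /h /h' enum_valK cast_ordKV enum_rankK.
pose E (x : word 'I_n) : word I := [ffun i => parity_extend x (h i)].
have bij_h : bijective h by exists h'.
have sumI (w : word I) : parity w = w (h' None) + \sum_j w (h' (Some j)).
  rewrite parityE (reindex h') /=; last by exists h => o _; rewrite ?hK ?h'K.
  rewrite (bigD1 None) //= (reindex_omap Some id) => [|[]] //.
  by congr (_ + _); apply: eq_bigl => j; rewrite eqxx.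
have ED x y : E (x + y) = E x + E y.
  apply/ffunP => i; rewrite !ffunE; case: (h i) => [j|] /=; first by rewrite ffunE.
  rewrite -[RHS](big_split _ _ _ x y).
  by apply: eq_bigr => j _; rewrite ffunE.
have Epoint j : E (point j) = point (h' None) + point (h' (Some j)).
  apply/ffunP => i; rewrite -[i]hK; move: (h i) => o; rewrite !ffunE h'K.
  rewrite !(can_eq h'K); case: o => [k|] /=; rewrite ?ffunE ?add0r //.
  by rewrite -parityE parity_point addr0.
have Ecut (w : word I) : parity w = 0 -> E [ffun j => w (h' (Some j))] = w.
  move=> w0; apply/ffunP => i; rewrite -[i]hK; move: (h i) => o; rewrite !ffunE h'K.
  case: o => [k|] /=; rewrite ?ffunE //.
  move/eqP: w0; rewrite sumI addr_eq0 oppF2 => /eqP ->.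
  by apply: eq_bigr => j _; rewrite ffunE.
have even_E x : parity (E x) = 0.
  rewrite sumI (eq_bigr x) => [|j _]; last by rewrite !ffunE h'K.
  by rewrite !ffunE h'K addF2.
have inj_E : injective E.
  move=> x y /ffunP e; apply/ffunP => j.
  by move: (e (h' (Some j))); rewrite !ffunE h'K.
(* Distance 0 corresponds to [i = h' None], where the two flips cancel, and a difference at [j] to
   [i = h' (Some j)]. *)
have ball x y : (hdist x y <= 1)%N ->
    exists i, E y = E x + point (h' None) + point i.
  rewrite leq_eqVlt ltnS leqn0 => /orP [/cards1P [j hj]|]; last first.
    rewrite cards_eq0 => /eqP/setP hxy; exists (h' None); rewrite addF2K.
    congr E; apply/ffunP => j; move: (hxy j); rewrite !inE => /negbFE/eqP ->.
    by [].
  exists (h' (Some j)); rewrite -addrA -Epoint -ED; congr E; apply/ffunP => k.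
  move/setP/(_ k): hj; rewrite !inE !ffunE; case: (k == j).
    by move: (x k) (y k) => [[|[|]] //= ?] [[|[|]] //= ?] _; apply/val_inj.
  by move/negbFE/eqP ->; rewrite addr0.
have ball_ex x i : exists2 y, (hdist x y <= 1)%N &
    E y = E x + point (h' None) + point i.
  rewrite -[i]hK; case: (h i) => [j|]; last first.
    exists x; rewrite ?addF2K // /hdist (_ : [set _ | _] = set0) ?cards0 //.
    by apply/setP => k; rewrite !inE eqxx.
  exists (x + point j); last by rewrite ED Epoint addrA.
  rewrite /hdist -[leqRHS](cards1 j) subset_leq_card //; apply/subsetP => k.
  by rewrite !inE !ffunE; case: (k == j); rewrite // addr0 eqxx.
exists n, [set x | E x \in C], h; split=> // [x|].
  (* [E x] is even, so inverting its parity bit gives an odd word. *)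
  have [|i [iC iU]] := flipC (E x + point (h' None)).
    by rewrite parityD even_E parity_point add0r.
  have [y xy Ey] := ball_ex x i; exists y; split; first by rewrite inE Ey.
  move=> z []; rewrite inE => zC /ball [k Ez]; apply: inj_E.
  by rewrite Ez Ey (iU k) // -Ez.
apply/setP => w; apply/idP/imsetP => [wC|[x]]; last by rewrite inE => ? ->.
exists [ffun j => w (h' (Some j))]; last by rewrite -/(E _) Ecut ?evenC.
by rewrite inE Ecut ?evenC.
Qed.

Section DoubledCode.
Variable r : nat.
Implicit Types (rho : {perm vec r}) (w : word (vec r + vec r)%type).

Lemma fstwD : {morph @fstw r : x y / x + y}.
Proof. by move=> x y; apply/ffunP => i; rewrite !ffunE. Qed.

Lemma sndwD : {morph @sndw r : x y / x + y}.
Proof. by move=> x y; apply/ffunP => i; rewrite !ffunE. Qed.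

Lemma fstw_inl (a : vec r) : fstw (point (inl a)) = point a.
Proof. by apply/ffunP => i; rewrite !ffunE. Qed.

Lemma fstw_inr (a : vec r) : fstw (point (inr a)) = 0.
Proof. by apply/ffunP => i; rewrite !ffunE. Qed.

Lemma sndw_inl (a : vec r) : sndw (point (inl a)) = 0.
Proof. by apply/ffunP => i; rewrite !ffunE. Qed.

Lemma sndw_inr (a : vec r) : sndw (point (inr a)) = point a.
Proof. by apply/ffunP => i; rewrite !ffunE. Qed.

Lemma parity_sum w : parity w = parity (fstw w) + parity (sndw w).
Proof.
by rewrite !parityE big_sumType; congr (_ + _); apply: eq_bigr => a _;
   rewrite ffunE.
Qed.

(** In an odd word exactly one half is odd. The flip must fall in that half, and the syndrome
    equation then fixes its position. *)
Lemma extended_perfect_SH rho : extended_perfect (SH rho).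
Proof.
apply: (@extended_perfect_crit _ (inl 0)) => w.
  by rewrite in_SH parity_sum => /and3P [/eqP -> /eqP -> _]; rewrite addr0.
have inlE a : (w + point (inl a) \in SH rho) =
    [&& parity (fstw w) != 0, parity (sndw w) == 0
      & syn (sndw w) == rho (syn (fstw w) + a)].
  rewrite in_SH fstwD sndwD fstw_inl sndw_inl addr0 !synD parityD syn_point.
  by rewrite parity_point addr_eq0 oppF2 F2_neq0.
have inrE a : (w + point (inr a) \in SH rho) =
    [&& parity (fstw w) == 0, parity (sndw w) != 0
      & syn (sndw w) + a == rho (syn (fstw w))].
  rewrite in_SH fstwD sndwD fstw_inr sndw_inr addr0 !synD parityD syn_point.
  by rewrite parity_point [_ + 1 == _]addr_eq0 oppF2 F2_neq0.
rewrite parity_sum; have [p0|p1] := eqVneq (parity (fstw w)) 0.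
  (* The right syndrome has to become [rho] of the left one, so the position is the sum of the
     actual and the required syndrome. *)
  rewrite p0 add0r => q1; exists (inr (rho (syn (fstw w)) + syn (sndw w))).
  split=> [|[b|b]]; rewrite ?inlE ?inrE ?p0 ?eqxx //.
    by rewrite q1 [_ + syn _]addrC addrA addF2 add0r eqxx.
  by case/and3P => _ _ /eqP <-; rewrite addrC addrA addF2 add0r.
have [q0 _|q1] := eqVneq (parity (sndw w)) 0; last first.
  by move: p1 q1; rewrite !F2_neq0 => /eqP -> /eqP ->; rewrite addF2.
(* Now the left syndrome has to become the preimage under [rho] of the right one. *)
exists (inl (syn (fstw w) + (rho^-1)%g (syn (sndw w)))).
split=> [|[b|b]]; rewrite ?inlE ?inrE ?p1 ?q0 ?eqxx ?andbF //.
  by rewrite addrA addF2 add0r permKV eqxx.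
by case/and3P => _ _ /eqP ->; rewrite permK addrA addF2 add0r.
Qed.

End DoubledCode.

(** * Propelinear structure *)

Section Permute.
Variable I : finType.

Lemma permuteD (p : {perm I}) : {morph permute p : x y / x + y}.
Proof. by move=> x y; apply/ffunP => i; rewrite !ffunE. Qed.

Lemma permuteM (p q : {perm I}) x :
  permute p (permute q x) = permute (q * p)%g x.
Proof. by apply/ffunP => i; rewrite !ffunE invMg permM. Qed.

Lemma permuteK (p : {perm I}) : cancel (permute p) (permute p^-1%g).
Proof.
by move=> x; apply/ffunP => i; rewrite !ffunE invgK permK.
Qed.

Lemma parity_permute (p : {perm I}) x : parity (permute p x) = parity x.
Proof. by rewrite /parity wsum_permute. Qed.

End Permute.

(** Write [p y = b + M *m y]. The permuted syndrome sums the vectors [b + M *m i] over the support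
    of [x], and the copies of [b] cancel because [x] is even. *)
Lemma syn_permute r (p : {perm vec r}) x : p \in GA r -> parity x = 0 ->
  p 0 + syn (permute p x) = p (syn x).
Proof.
rewrite inE => /existsP [b /existsP [M /andP [_ /forallP pE]]] x0.
have {}pE y : p y = b + M *m y by apply/eqP.
rewrite !pE mulmx0 addr0; congr (_ + _).
rewrite /syn wsum_permute /wsum mulmx_sumr.
rewrite (eq_bigr (fun i => (x i : 'F_2) *: b + M *m ((x i : 'F_2) *: i))) => [|i _].
  by rewrite big_split -scaler_suml -parityE x0 scale0r /= add0r.
by rewrite /= pE scalerDr -scalemxAr.
Qed.

Section SumPerm.
Variable r : nat.
Implicit Types p q : {perm vec r}.

Definition sum_perm_fun p q (k : vec r + vec r) : vec r + vec r :=
  match k with inl a => inl (p a) | inr b => inr (q b) end.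

Lemma sum_perm_inj p q : injective (sum_perm_fun p q).
Proof. by move=> [a|a] [b|b] //= [/perm_inj ->]. Qed.

Definition sum_perm p q : {perm (vec r + vec r)%type} := perm (@sum_perm_inj p q).

Lemma fstw_permute p q w : fstw (permute (sum_perm p q) w) = permute p (fstw w).
Proof.
apply/ffunP => a; rewrite !ffunE; congr (w _).
by apply: (canLR (permK _)); rewrite permE /= permKV.
Qed.

Lemma sndw_permute p q w : sndw (permute (sum_perm p q) w) = permute q (sndw w).
Proof.
apply/ffunP => a; rewrite !ffunE; congr (w _).
by apply: (canLR (permK _)); rewrite permE /= permKV.
Qed.

End SumPerm.

(** * A regular group on the code from affine maps compatible with [rho] *)

Section Propelinear.
Variables (r : nat) (rho : {perm vec r}) (g : vec r -> {perm vec r}).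
Hypothesis gGA : forall a, g a \in GA r.
Hypothesis g0 : forall a, g a 0 = a.
Hypothesis gM : forall a b, g (g a b) = (g b * g a)%g.
Hypothesis g_rho : forall a b, rho (g a b) = g (rho a) (rho b).
Local Notation C := (SH rho).

Lemma g_at0 : g 0 = 1%g.
Proof. by apply: (mulgI (g 0)); rewrite -gM g0 mulg1. Qed.

(** The permutation [g (rho 0)] sends both 0 and [rho 0] to [rho 0]. *)
Lemma rho_at0 : rho 0 = 0.
Proof.
by apply: (@perm_inj _ (g (rho 0))); rewrite -g_rho !g0.
Qed.

Lemma SH_0 : 0 \in C.
Proof.
have f0 : fstw (0 : word (vec r + vec r)%type) = 0.
  by apply/ffunP => a; rewrite !ffunE.
have s0 : sndw (0 : word (vec r + vec r)%type) = 0.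
  by apply/ffunP => a; rewrite !ffunE.
by rewrite in_SH f0 s0 /parity /syn !linear0 rho_at0 !eqxx.
Qed.

(** For a codeword [c] the right factor is [g] at the syndrome of the right half. *)
Definition coord_perm (c : word (vec r + vec r)%type) :=
  sum_perm (g (syn (fstw c))) (g (rho (syn (fstw c)))).

Definition prop_fun c x := c + permute (coord_perm c) x.

Lemma prop_fun_inj c : injective (prop_fun c).
Proof. by move=> x y /addrI/(can_inj (permuteK _)). Qed.

Definition prop_perm c : {perm word (vec r + vec r)%type} := perm (@prop_fun_inj c).

Lemma prop_permE c x : prop_perm c x = c + permute (coord_perm c) x.
Proof. exact: permE. Qed.

(** Since [g a 0 = a], the syndrome of [c] is exactly the constant term that [syn_permute] adds. *)
Lemma prop_syn c x : x \in C ->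
  syn (fstw (prop_perm c x)) = g (syn (fstw c)) (syn (fstw x)).
Proof.
rewrite in_SH => /and3P [/eqP px _ _].
by rewrite prop_permE fstwD fstw_permute synD -syn_permute ?g0.
Qed.

(** With [a] and [b] the left syndromes of [c] and [x], the right syndrome becomes
    [g (rho a) (rho b)], which is [rho (g a b)] by [g_rho]. *)
Lemma prop_closed c x : c \in C -> x \in C -> prop_perm c x \in C.
Proof.
move=> cC xC; rewrite in_SH prop_syn // prop_permE !fstwD !sndwD.
move: cC xC; rewrite !in_SH => /and3P [/eqP pc /eqP qc /eqP sc].
case/and3P => /eqP px /eqP qx /eqP sx.
rewrite fstw_permute sndw_permute !parityD !parity_permute pc qc px qx addr0 eqxx /=.
by rewrite synD sc g_rho -sx -(syn_permute (gGA _) qx) g0.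
Qed.

(** The translation parts agree at once. The coordinate parts agree by [prop_syn] and [gM], with
    [g_rho] for the right half. Products of permutations apply the left factor first. *)
Lemma prop_permM c d : c \in C -> d \in C ->
  (prop_perm d * prop_perm c)%g = prop_perm (prop_perm c d).
Proof.
move=> cC dC; apply/permP => x; rewrite permM !prop_permE permuteD addrA.
congr (_ + _); rewrite permuteM; congr (permute _ x).
apply/permP => k; rewrite permM !permE /coord_perm -prop_permE prop_syn //.
by case: k => a /=; rewrite ?g_rho gM permM.
Qed.

Lemma prop_perm_at0 c : prop_perm c 0 = c.
Proof.
rewrite prop_permE -[RHS]addr0; congr (_ + _).
by apply/ffunP => i; rewrite !ffunE.
Qed.

Lemma prop_group_set : group_set [set prop_perm c | c in C].
Proof.
apply/group_setP; split.
  apply/imsetP; exists 0; first exact: SH_0.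
  apply/permP => x; rewrite perm1 prop_permE add0r.
  have s0 : syn (fstw (0 : word (vec r + vec r)%type)) = 0.
    by rewrite -[RHS](linear0 (@syn r)); congr syn; apply/ffunP => a; rewrite !ffunE.
  suff -> : coord_perm 0 = 1%g by apply/ffunP => k; rewrite ffunE invg1 perm1.
  apply/permP => k; rewrite permE /coord_perm s0 rho_at0 g_at0 perm1.
  by case: k => a /=; rewrite perm1.
move=> _ _ /imsetP [d dC ->] /imsetP [c cC ->].
by rewrite prop_permM // imset_f // prop_closed.
Qed.

(** [prop_perm c] sends 0 to [c], which yields both transitivity and the order of the group. *)
Lemma propelinear_SH : propelinear C.
Proof.
exists (group prop_group_set).
  apply/subsetP => _ /imsetP [c cC ->]; rewrite !inE; apply/andP; split.
    apply/existsP; exists c; apply/existsP; exists (coord_perm c).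
    by apply/forallP => x; rewrite prop_permE.
  rewrite eqEcard card_imset ?leqnn ?andbT; last exact: perm_inj.
  by apply/subsetP => _ /imsetP [x xC ->]; apply: prop_closed.
split; last first.
  by rewrite card_imset // => c d /permP/(_ 0); rewrite !prop_perm_at0.
apply/imsetP; exists 0; first exact: SH_0.
apply/setP => c; apply/idP/imsetP => [cC|[_ /imsetP [d dC ->] ->]].
  by exists (prop_perm c); rewrite /= ?imset_f //= apermE prop_perm_at0.
by rewrite /= apermE prop_perm_at0.
Qed.

End Propelinear.

(** * Rank and kernel *)

Section Rank.
Variable r : nat.
Implicit Types (rho : {perm vec r}) (w : word (vec r + vec r)%type).

Lemma fstw_is_linear : linear (@fstw r).
Proof. by move=> k x y; apply/ffunP => i; rewrite !ffunE. Qed.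

Lemma sndw_is_linear : linear (@sndw r).
Proof. by move=> k x y; apply/ffunP => i; rewrite !ffunE. Qed.

Definition both_parity w : ('F_2)^o * ('F_2)^o :=
  (parity (fstw w), parity (sndw w)).

Definition both_syn w : vec r * vec r := (syn (fstw w), syn (sndw w)).

Lemma both_parity_is_linear : linear both_parity.
Proof.
by move=> k x y; rewrite /both_parity /parity fstw_is_linear sndw_is_linear !linearP.
Qed.

Lemma both_syn_is_linear : linear both_syn.
Proof.
by move=> k x y; rewrite /both_syn /syn fstw_is_linear sndw_is_linear !linearP.
Qed.

HB.instance Definition _ := GRing.isLinear.Build 'F_2
  (word (vec r + vec r)%type) (('F_2)^o * ('F_2)^o)%type *:%R both_parity
  both_parity_is_linear.

HB.instance Definition _ := GRing.isLinear.Build 'F_2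
  (word (vec r + vec r)%type) (vec r * vec r)%type *:%R both_syn
  both_syn_is_linear.

Lemma card_vec : #|{: vec r}| = (2 ^ r)%N.
Proof. by rewrite card_mx card_Fp // muln1. Qed.

(** Serves both the code and its kernel: 2 counts the parity equations, [r + r] the syndrome
    coordinates. *)
Lemma span_dim_preimage (C : {set word (vec r + vec r)%type})
    (L : {set vec r * vec r}) : 0 \in L ->
  (forall w, (w \in C) = (both_parity w == 0) && (both_syn w \in L)) ->
  (span_dim C + (2 + (r + r)) = 2 ^ r + 2 ^ r + \dim <<enum L>>)%N.
Proof.
move=> L0 memC.
have := @dim_span_preimage _ _ _ _ (linfun both_parity) (linfun both_syn)
  (enum C) (enum L).
have -> : dim (word (vec r + vec r)%type) = (2 ^ r + 2 ^ r)%N.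
  by rewrite -card_vec -card_sum -[RHS]muln1.
have -> : dim (('F_2)^o * ('F_2)^o : vectType 'F_2)%type = 2%N by [].
have -> : dim (vec r * vec r : vectType 'F_2)%type = (r + r)%N.
  by rewrite -[in RHS](muln1 r).
apply; last by rewrite mem_enum.
  move=> [t t'] [a a'].
  (* [point 0] has syndrome 0 and parity 1, so it adjusts the parity to [s] without moving the
     syndrome [b]. *)
  pose x (s : 'F_2) (b : vec r) : word (vec r) := point b + (s + 1) *: point 0.
  have px s b : parity (x s b) = s.
    rewrite /x /parity linearD linearZ /= -!/(parity _) !parity_point.
    by rewrite addrC -[_ *: _]/(_ * _) mulr1 [LHS](@addF2K ('F_2)^o).
  have sx s b : syn (x s b) = b.
    by rewrite /x /syn linearD linearZ /= -!/(syn _) !syn_point scaler0 addr0.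
  clearbody x; exists (concat (x t a) (x t' a')); rewrite lfunE /=.
    by rewrite /both_parity fstw_concat sndw_concat !px.
  by rewrite /both_syn fstw_concat sndw_concat !sx.
by move=> w; rewrite !mem_enum !lfunE memC.
Qed.

Definition graph (A : {set vec r}) rho : {set vec r * vec r} :=
  [set (a, rho a) | a in A].

Definition graph_dim rho : nat := \dim <<enum (graph setT rho)>>.

Lemma mem_graph A rho a b : ((a, b) \in graph A rho) = (a \in A) && (b == rho a).
Proof.
apply/imsetP/andP => [[c cA [-> ->]] //|[aA /eqP ->]].
by exists a.
Qed.

Lemma in_SH_graph rho w :
  (w \in SH rho) = (both_parity w == 0) && (both_syn w \in graph setT rho).
Proof. by rewrite in_SH mem_graph inE -[both_parity w == 0]/(_ && _) andbA. Qed.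

Lemma rank_SH rho : rho 0 = 0 ->
  (rank (SH rho) + (2 + (r + r)) = 2 ^ r + 2 ^ r + graph_dim rho)%N.
Proof.
move=> rho0; apply: span_dim_preimage => [|w]; last exact: in_SH_graph.
by rewrite mem_graph inE rho0 eqxx.
Qed.

Lemma wsum_pair (I : finType) (U1 U2 : vectType 'F_2) (f1 : I -> U1)
    (f2 : I -> U2) x : (wsum f1 x, wsum f2 x) = wsum (fun i => (f1 i, f2 i)) x.
Proof. by rewrite /wsum; elim/big_rec3: _ => [|i s t u _ <-]. Qed.

(** The intersection is the kernel, on even words, of the linear extension of [f], whose values are
    the points of the graph. The even words have dimension [2 ^ r - 1], and their image is the span
    of the graph. *)
Lemma span_dim_H_permute rho : rho 0 = 0 ->
  (span_dim (H r :&: permute rho @: H r) + (1 + graph_dim rho) = 2 ^ r)%N.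
Proof.
move=> rho0; set X := H r :&: _.
pose f (b : vec r) : vec r * vec r := ((rho^-1)%g b, b).
have gE c : wsum f c = (syn (permute rho^-1%g c), syn c).
  by rewrite /syn wsum_permute wsum_pair.
pose p : 'Hom(word (vec r), ('F_2)^o) := linfun (@parity (vec r)).
pose g : 'Hom(word (vec r), (vec r * vec r)%type) := linfun (wsum f).
have memX c : (c \in X) = (p c == 0) && (g c == 0).
  rewrite inE in_H !lfunE /= gE -[(_, _) == 0]/(_ && _).
  have -> : (c \in permute rho @: H r) = (permute rho^-1%g c \in H r).
    apply/imsetP/idP => [[h hH ->]|cH]; first by rewrite permuteK.
    exists (permute rho^-1%g c) => //.
    by rewrite -[LHS](permuteK rho^-1%g) invgK.
  by rewrite in_H parity_permute andbACA andbb; congr (_ && _); apply: andbC.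
have -> : span_dim X = \dim (lker p :&: lker g).
  congr (\dim _); apply: span_lker2 => c; rewrite mem_enum; exact: memX.
have -> : graph_dim rho = \dim (g @: lker p).
  congr (\dim _); apply/eqP; rewrite eqEsubv; apply/andP; split.
    apply/span_subvP => z; rewrite mem_enum => /imsetP [a _ -> {z}].
    have inv0 : (rho^-1)%g 0 = 0 by rewrite -{1}rho0 permK.
    (* The extra [point 0] makes the word even and contributes 0, since [rho] fixes 0. *)
    have -> : (a, rho a) = g (point (rho a) + point 0).
      by rewrite lfunE /= linearD /= !wsum_point /f permK inv0 [RHS]addr0.
    by apply: memv_img; rewrite memv_ker lfunE /= linearD /= !wsum_point addF2.
  apply/subvP => _ /memv_imgP [c _ ->]; rewrite lfunE /=.
  move: (wsum_in_span f c); apply/subvP/sub_span => _ /codomP [b ->].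
  by rewrite mem_enum mem_graph inE permKV eqxx.
rewrite addnCA limg_ker_dim.
have dimp : \dim (limg p) = 1%N.
  suff -> : limg p = fullv by rewrite dimvf.
  apply/eqP; rewrite eqEsubv subvf; apply/subvP => t _.
  suff <- : p (t *: point 0) = t by rewrite memv_img ?memvf.
  by rewrite lfunE /= linearZ /= wsum_point -[_ *: _]/(_ * _) mulr1.
have := limg_ker_dim p fullv; rewrite capfv dimp dimvf addnC => ->.
by rewrite -card_vec -[RHS]muln1.
Qed.

Lemma distensionE rho : rho 0 = 0 ->
  distension rho = (graph_dim rho)%:Z - r%:Z.
Proof.
move=> /span_dim_H_permute e; rewrite /distension -e !PoszD [LHS]addrC !addrA.
by rewrite addNr add0r -!addrA [LHS]addrC !addrA subrK.
Qed.

End Rank.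

(** * The kernel of the code and the deficiency of [rho] *)

Section Kernel.
Variable r : nat.
Implicit Types (rho : {perm vec r}) (a b k : vec r).

Definition translations rho : {set vec r} :=
  [set k | [forall a, rho (a + k) == rho a + rho k]].

Lemma translationsP rho k :
  reflect (forall a, rho (a + k) = rho a + rho k) (k \in translations rho).
Proof. by rewrite inE; apply: (iffP forallP) => h a; apply/eqP. Qed.

Lemma translations0 rho : rho 0 = 0 -> 0 \in translations rho.
Proof. by move=> rho0; apply/translationsP => a; rewrite rho0 !addr0. Qed.

Lemma translationsD rho : {in translations rho &, forall k l,
  k + l \in translations rho}.
Proof.
move=> k l /translationsP hk /translationsP hl; apply/translationsP => a.
by rewrite addrA !hl hk addrA.
Qed.

(** By cardinality an inclusion of the translate suffices. Translating 0 puts [w] in the code;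
    translating a codeword with syndromes [(a, rho a)] gives the additivity condition at [a]. *)
Lemma memKer rho w : rho 0 = 0 -> (w \in Ker (SH rho)) =
  (both_parity w == 0) && (both_syn w \in graph (translations rho) rho).
Proof.
move=> rho0; rewrite inE.
have -> : ([set w + y | y in SH rho] == SH rho) =
    [forall y in SH rho, w + y \in SH rho].
  rewrite eqEcard card_imset ?leqnn ?andbT; last exact: addrI.
  apply/subsetP/forall_inP => [s y yC|s _ /imsetP [y yC ->]]; last exact: s.
  by apply: s; apply: imset_f.
have SHE v : (v \in SH rho) = (both_parity v == 0) &&
    (syn (sndw v) == rho (syn (fstw v))).
  by rewrite in_SH_graph mem_graph inE.
have synS v y : (syn (sndw (v + y)) = syn (sndw v) + syn (sndw y)) *
    (syn (fstw (v + y)) = syn (fstw v) + syn (fstw y)).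
  by rewrite sndwD fstwD !synD.
rewrite mem_graph; apply/forall_inP/and3P => [s|[p0 /translationsP hk /eqP e] y].
  have par a : exists2 y, both_parity y == 0 & both_syn y = (a, rho a).
    exists (concat (point a + point 0) (point (rho a) + point 0)).
      by rewrite /both_parity fstw_concat sndw_concat !parityD !parity_point addF2.
    by rewrite /both_syn fstw_concat sndw_concat !synD !syn_point !addr0.
  have C0 : 0 \in SH rho.
    by rewrite in_SH_graph !linear0 eqxx mem_graph inE rho0 eqxx.
  have := s _ C0; rewrite addr0 SHE => /andP [p0 /eqP e].
  split; rewrite ?e //; apply/translationsP => a.
  have [y py [ya yra]] := par a.
  have yC : y \in SH rho by rewrite SHE py ya yra eqxx.
  have := s _ yC; rewrite SHE => /andP [_ /eqP]; rewrite !synS e ya yra.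
  by rewrite [in RHS]addrC => <-; rewrite addrC.
rewrite !SHE !synS => /andP [q0 /eqP f]; rewrite linearD /= (eqP p0) (eqP q0) addr0.
by rewrite eqxx e f addrC -hk addrC eqxx.
Qed.

(** Measured on the graph rather than on [translations rho] itself, so that [span_dim_preimage]
    applies directly. *)
Definition kernel_dim rho : nat := \dim <<enum (graph (translations rho) rho)>>.

(** [rho] is additive on [translations rho], so the graph over it is closed under addition. *)
Lemma card_translations rho : rho 0 = 0 ->
  #|translations rho| = (2 ^ kernel_dim rho)%N.
Proof.
move=> rho0; have <- : #|graph (translations rho) rho| = #|translations rho|.
  by rewrite card_imset // => a b [].
rewrite cardE; apply: size_add_closed; rewrite ?enum_uniq ?mem_enum //.
  by rewrite mem_graph translations0 // rho0 eqxx.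
move=> [a b] [c d]; rewrite !mem_enum !mem_graph.
case/andP => aK /eqP -> /andP [cK /eqP ->]; rewrite translationsD //=.
by move/translationsP: cK => ->.
Qed.

Lemma dim_Ker_SH rho : rho 0 = 0 ->
  (span_dim (Ker (SH rho)) + (2 + (r + r)) = 2 ^ r + 2 ^ r + kernel_dim rho)%N.
Proof.
move=> rho0; apply: span_dim_preimage => [|w]; last exact: memKer.
by rewrite mem_graph translations0 // rho0 eqxx.
Qed.

(** If the image of a triple through [a] is a triple through [rho a], then [rho b] and [rho (a + b)]
    are its two other members, whose sum is [rho a]. *)
Lemma star_preserved_translation rho a : rho 0 = 0 -> a != 0 ->
  ([set rho @: (t : {set vec r}) | t in Star a] == Star (rho a)) =
  (a \in translations rho).
Proof.
move=> rho0 a0.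
have im3 b : rho @: [set a; b; a + b] = [set rho a; rho b; rho (a + b)].
  by rewrite !imsetU !imset_set1.
apply/eqP/translationsP => [e b|h].
  have [->|b0] := eqVneq b 0; first by rewrite rho0 !add0r.
  have [->|ba] := eqVneq b a; first by rewrite !addF2 rho0.
  have : rho @: [set a; b; a + b] \in Star (rho a).
    rewrite -e; apply: imset_f; apply/imsetP; exists b => //.
    by rewrite !inE negb_or b0 ba.
  rewrite im3 => /imsetP [c _ /setP e3].
  have := e3 (rho b); have := e3 (rho (a + b)).
  have n1 : rho b != rho a by rewrite (inj_eq perm_inj).
  have n2 : rho (a + b) != rho a.
    by rewrite (inj_eq perm_inj) -subr_eq0 addrAC subrr add0r.
  have n3 : rho (a + b) != rho b.
    by rewrite (inj_eq perm_inj) -subr_eq0 addrK.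
  rewrite !inE !eqxx !orbT /= (negbTE n1) (negbTE n2) /= => /esym h1 /esym h2.
  rewrite [b + a]addrC; case/orP: h1 => /eqP h1; case/orP: h2 => /eqP h2;
    move: n3; rewrite h1 h2 ?eqxx // => _.
    by rewrite addrAC addF2 add0r.
  by rewrite addrC.
have {}h b : rho (a + b) = rho a + rho b by rewrite addrC h addrC.
apply/setP => t; apply/imsetP/imsetP => [[_ /imsetP [b bP ->] ->]|[c cP ->]].
  exists (rho b); last by rewrite im3 h.
  move: bP; rewrite !inE !negb_or => /andP [b0 ba].
  by rewrite -{1}rho0 !(inj_eq perm_inj) b0.
move: cP; rewrite -[c](permKV rho); move: ((rho^-1)%g c) => b bP.
exists [set a; b; a + b]; last by rewrite im3 h.
apply: imset_f; move: bP.
by rewrite !inE !negb_or -{1}rho0 !(inj_eq perm_inj) => /andP [-> ->].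
Qed.

(** The added 1 counts the vector 0, so the logarithm is taken of an exact power of two. *)
Lemma deficiencyE rho : rho 0 = 0 ->
  deficiency rho = r%:Z - (kernel_dim rho)%:Z.
Proof.
move=> rho0; rewrite /deficiency.
have -> : star_preserved rho = translations rho :\ 0.
  apply/setP => a; rewrite inE in_setD1; case: eqVneq => //= a0.
  exact: star_preserved_translation.
rewrite addn1; have -> : #|translations rho :\ 0|.+1 = #|translations rho|.
  by rewrite [RHS](cardsD1 (0 : vec r)) translations0.
by rewrite card_translations // trunc_expnK.
Qed.

End Kernel.

(** * Additivity under concatenation of permutations *)

Section Blocks.
Variables r1 r2 : nat.
Implicit Type w : (vec (r1 + r2) * vec (r1 + r2))%type.

Definition usub_pair w : vec r1 * vec r1 := (usubmx w.1, usubmx w.2).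
Definition dsub_pair w : vec r2 * vec r2 := (dsubmx w.1, dsubmx w.2).
(** The section of [dsub_pair] with values in the kernel of [usub_pair], used as [j] in
    [dim_span_pair]. *)
Definition dcol_pair (w : vec r2 * vec r2) : vec (r1 + r2) * vec (r1 + r2) :=
  (col_mx 0 w.1, col_mx 0 w.2).

Lemma usub_pair_is_linear : linear usub_pair.
Proof. by move=> k x y; rewrite /usub_pair /= !linearP. Qed.

Lemma dsub_pair_is_linear : linear dsub_pair.
Proof. by move=> k x y; rewrite /dsub_pair /= !linearP. Qed.

Lemma dcol_pair_is_linear : linear dcol_pair.
Proof.
have colP k (a b : vec r2) :
    col_mx (0 : vec r1) (k *: a + b) = k *: col_mx 0 a + col_mx 0 b.
  by rewrite scale_col_mx add_col_mx scaler0 add0r.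
by move=> k x y; rewrite /dcol_pair /= !colP.
Qed.

HB.instance Definition _ := GRing.isLinear.Build 'F_2
  (vec (r1 + r2) * vec (r1 + r2))%type (vec r1 * vec r1)%type *:%R usub_pair
  usub_pair_is_linear.

HB.instance Definition _ := GRing.isLinear.Build 'F_2
  (vec (r1 + r2) * vec (r1 + r2))%type (vec r2 * vec r2)%type *:%R dsub_pair
  dsub_pair_is_linear.

HB.instance Definition _ := GRing.isLinear.Build 'F_2
  (vec r2 * vec r2)%type (vec (r1 + r2) * vec (r1 + r2))%type *:%R dcol_pair
  dcol_pair_is_linear.

End Blocks.

Section Concatenation.
Variables (r1 r2 : nat) (tau : {perm vec r1}) (sigma : {perm vec r2}).
Hypotheses (tau0 : tau 0 = 0) (sigma0 : sigma 0 = 0).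
Local Notation rho := (vconcat tau sigma).

Lemma vconcatE a b : rho (col_mx a b) = col_mx (tau a) (sigma b).
Proof. by rewrite permE /vconcat_fun col_mxKu col_mxKd. Qed.

Lemma vconcat0 : rho 0 = 0.
Proof. by rewrite -col_mx0 vconcatE tau0 sigma0. Qed.

(** As [tau] fixes 0, padding with zero blocks embeds the graph of [sigma] into that of [rho]. *)
Lemma graph_dim_vconcat :
  graph_dim rho = (graph_dim tau + graph_dim sigma)%N.
Proof.
rewrite /graph_dim.
apply: (@dim_span_pair _ _ _ _ (linfun (@usub_pair r1 r2))
  (linfun (@dsub_pair r1 r2)) (linfun (@dcol_pair r1 r2))).
- move=> [x y]; rewrite !lfunE /= /usub_pair /dcol_pair /dsub_pair /= => -[ux uy].
  by rewrite -{1}ux -uy !vsubmxK.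
- by move=> [x y]; rewrite !lfunE /= /usub_pair /dcol_pair /= !col_mxKu.
- by move=> [x y]; rewrite !lfunE /= /dsub_pair /dcol_pair /= !col_mxKd.
- move=> [x y]; rewrite mem_enum mem_graph inE; apply/mapP/eqP => [[w]|->].
    rewrite mem_enum => /imsetP [a _ ->]; rewrite lfunE /= /usub_pair /= => -[-> ->].
    by rewrite -[in LHS](vsubmxK a) vconcatE col_mxKu.
  exists (col_mx x 0, rho (col_mx x 0)); first by rewrite mem_enum mem_graph inE /=.
  by rewrite lfunE /= /usub_pair /= vconcatE !col_mxKu.
- move=> z /mapP [w]; rewrite !mem_enum => /imsetP [a _ ->].
  rewrite lfunE /= /dsub_pair /= => ->; rewrite mem_graph inE /=.
  by rewrite -[in X in dsubmx X](vsubmxK a) vconcatE col_mxKd.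
move=> z; rewrite mem_enum => /imsetP [b _ ->]; rewrite lfunE /= /dcol_pair /=.
by apply: memv_span; rewrite mem_enum mem_graph inE vconcatE tau0 eqxx.
Qed.

Lemma mem_translations_vconcat a b :
  (col_mx a b \in translations rho) =
  (a \in translations tau) && (b \in translations sigma).
Proof.
apply/translationsP/andP => [h|[/translationsP ha /translationsP hb] x].
  split; apply/translationsP => x.
    by have := h (col_mx x 0); rewrite add_col_mx !vconcatE add_col_mx => /eq_col_mx [].
  by have := h (col_mx 0 x); rewrite add_col_mx !vconcatE add_col_mx => /eq_col_mx [].
by rewrite -[x]vsubmxK add_col_mx !vconcatE ha hb add_col_mx.
Qed.

(** Compares powers of two: the translations of [rho] form the product of those of [tau] and
    [sigma]. *)
Lemma kernel_dim_vconcat :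
  kernel_dim rho = (kernel_dim tau + kernel_dim sigma)%N.
Proof.
apply/eqP; rewrite -(eqn_exp2l _ _ (isT : 1 < 2)%N) expnD -!card_translations //.
  rewrite -cardsX -(card_imset _ (f := fun p => col_mx p.1 p.2)); last first.
    by move=> [a b] [c e] /= /eq_col_mx [-> ->].
  apply/eqP; congr #|pred_of_set _|; apply/setP => k.
  apply/idP/imsetP => [|[[a b]]]; last first.
    by rewrite inE /= => ab ->; rewrite mem_translations_vconcat.
  rewrite -{1}(vsubmxK k) mem_translations_vconcat => ab.
  by exists (usubmx k, dsubmx k); [rewrite inE | rewrite /= vsubmxK].
exact: vconcat0.
Qed.

End Concatenation.

(** * Regular subgroups of the affine group *)

Section InducedPermutation.
Variables (r : nat) (G : {group {perm vec r}}).
Hypothesis hG : regular_GA G.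

(** Transitivity puts [a] in the orbit of 0, which excludes the default branch. *)
Lemma elt_toP a : elt_to G a \in G /\ elt_to G a 0 = a.
Proof.
rewrite /elt_to; case: pickP => [g /andP [gG /eqP //]|noG].
have /= := noG; case: hG => _ [trG _].
have /imsetP [g gG aE] : a \in orbit 'P G 0.
  by rewrite (atransP trG) ?inE.
by move/(_ g); rewrite gG aE /= apermE eqxx.
Qed.

(* |G| equals the number of vectors, so g |-> g(0) is a bijection on G. *)
Lemma eval0_inj : {in G &, injective (fun g : {perm vec r} => g 0)}.
Proof.
case: hG => _ [trG cG]; apply/imset_injP; rewrite cG; apply/eqP.
congr #|pred_of_set _|; apply/setP => a; rewrite inE; apply/imsetP.
by have [gG g0] := elt_toP a; exists (elt_to G a).
Qed.

(** Both sides lie in [G] and send 0 to the same vector. *)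
Lemma elt_toM a b : elt_to G (elt_to G a b) = (elt_to G b * elt_to G a)%g.
Proof.
have [aG a0] := elt_toP a; have [bG b0] := elt_toP b.
have [cG c0] := elt_toP (elt_to G a b).
by apply: eval0_inj; rewrite ?groupM // permM c0 b0.
Qed.

Lemma elt_to_GA a : elt_to G a \in GA r.
Proof. by case: hG => /subsetP s _; apply: s; case: (elt_toP a). Qed.

(** Apply [T] to the product of the elements at [b] and [a], once as a single element and once
    factor by factor, and evaluate at 0. *)
Lemma induced_elt_to (T : {perm {perm vec r}}) (tau : {perm vec r}) a b :
  T \in Aut G -> induced_by G T tau ->
  tau (elt_to G a b) = elt_to G (tau a) (tau b).
Proof.
move=> autT indT; have [aG a0] := elt_toP a; have [bG b0] := elt_toP b.
have [_ <-] := elt_toP (tau (elt_to G a b)); rewrite -indT elt_toM.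
have -> : T (elt_to G b * elt_to G a)%g = (T (elt_to G b) * T (elt_to G a))%g.
  by rewrite -!(autmE autT) morphM.
by rewrite !indT permM; have [_ ->] := elt_toP (tau b).
Qed.

Lemma induced0 (T : {perm {perm vec r}}) (tau : {perm vec r}) :
  T \in Aut G -> induced_by G T tau -> tau 0 = 0.
Proof.
move=> autT indT; apply: (@rho_at0 _ _ (elt_to G)) => [a|a b].
  by case: (elt_toP a).
exact: induced_elt_to autT indT.
Qed.

End InducedPermutation.

Lemma vconcat_GA r1 r2 (p : {perm vec r1}) (q : {perm vec r2}) :
  p \in GA r1 -> q \in GA r2 -> vconcat p q \in GA (r1 + r2).
Proof.
rewrite !inE => /existsP [a /existsP [M /andP [uM /forallP pE]]].
case/existsP => b /existsP [N /andP [uN /forallP qE]].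
apply/existsP; exists (col_mx a b); apply/existsP; exists (block_mx M 0 0 N).
apply/andP; split.
  by move: uM uN; rewrite !unitmxE det_ublock unitrM => -> ->.
apply/forallP => x; rewrite -[x]vsubmxK vconcatE (eqP (pE _)) (eqP (qE _)).
by rewrite mul_block_col !mul0mx addr0 add0r add_col_mx.
Qed.

Theorem theorem3 (r1 r2 : nat) (hr1 : (1 <= r1)%N) (hr2 : (1 <= r2)%N)
    (G1 : {group {perm vec r1}}) (G2 : {group {perm vec r2}})
    (hG1 : regular_GA G1) (hG2 : regular_GA G2)
    (T : {perm {perm vec r1}}) (S : {perm {perm vec r2}})
    (hT : T \in Aut G1) (hS : S \in Aut G2)
    (tau : {perm vec r1}) (sigma : {perm vec r2})
    (htau : induced_by G1 T tau) (hsigma : induced_by G2 S sigma)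
    (l1 l2 k1 k2 : int)
    (hl1 : l1 = distension tau) (hl2 : l2 = distension sigma)
    (hk1 : k1 = deficiency tau) (hk2 : k2 = deficiency sigma) :
  let C := SH (vconcat tau sigma) in
  [/\ propelinear C,
      extended_perfect C,
      code_length C = (2 ^ (r1 + r2 + 1))%N,
      (rank C)%:Z = (2 ^ (r1 + r2 + 1))%N%:Z - r1%:Z - r2%:Z - 2 + l1 + l2 &
      (span_dim (Ker C))%:Z =
        (2 ^ (r1 + r2 + 1))%N%:Z - r1%:Z - r2%:Z - 2 - k1 - k2].
Proof.
have tau0 := induced0 hG1 hT htau; have sigma0 := induced0 hG2 hS hsigma.
have rho0 := vconcat0 tau0 sigma0.
have pow2 : (2 ^ (r1 + r2 + 1) = 2 ^ (r1 + r2) + 2 ^ (r1 + r2))%N.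
  by rewrite addn1 expnS mul2n addnn.
split.
(* The direct product of [G1] and [G2], acting blockwise and indexed by the image of 0. *)
- pose g v := vconcat (elt_to G1 (usubmx v)) (elt_to G2 (dsubmx v)).
  have gE v a b : g v (col_mx a b) =
      col_mx (elt_to G1 (usubmx v) a) (elt_to G2 (dsubmx v) b) by apply: vconcatE.
  apply: (@propelinear_SH _ _ g) => [v|v|v w|v w].
  + by apply: vconcat_GA; apply: elt_to_GA.
  + rewrite -col_mx0 gE; have [_ ->] := elt_toP hG1 (usubmx v).
    by have [_ ->] := elt_toP hG2 (dsubmx v); rewrite vsubmxK.
  + apply/permP => x; rewrite -[x]vsubmxK -[w]vsubmxK permM !gE.
    by rewrite !col_mxKu !col_mxKd !elt_toM // !permM.
  rewrite -[v]vsubmxK -[w]vsubmxK gE !vconcatE !col_mxKu !col_mxKd.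
  by rewrite (induced_elt_to hG1 _ _ hT htau) (induced_elt_to hG2 _ _ hS hsigma).
- exact: extended_perfect_SH.
- by rewrite /code_length card_sum card_vec.
(* The graph dimensions are [l1 + r1] and [l2 + r2]. Passing to integers makes the subtractions
   exact. *)
- have := rank_SH rho0; rewrite graph_dim_vconcat // -pow2 => /(congr1 Posz).
  rewrite hl1 hl2 !distensionE // !PoszD => e.
  by move/(canRL (addrK _)): e => ->; ring.
have := dim_Ker_SH rho0; rewrite kernel_dim_vconcat // -pow2 => /(congr1 Posz).
rewrite hk1 hk2 !deficiencyE // !PoszD => e.
by move/(canRL (addrK _)): e => ->; ring.
Qed.
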